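(* Let $\mathcal{A}$ be a nice GFG-tNCW that is minimal, i.e., no GFG-tNCW recognizing $L(\mathcal{A})$ has fewer states than $\mathcal{A}$. Then $\mathcal{A}$ is safe-centralized and safe-minimal.
   Context: A tNCW is $\mathcal{A}=\langle \Sigma,Q,q_0,\delta,\alpha\rangle$ with finite alphabet $\Sigma$, finite state set $Q$, initial state $q_0$, total transition function $\delta:Q\times\Sigma\to 2^Q\setminus\{\emptyset\}$ with transition relation $\Delta=\{\langle q,\sigma,s\rangle: s\in\delta(q,\sigma)\}$, and $\alpha\subseteq\Delta$ ($\alpha$-transitions; the rest are $\bar\alpha$-transitions); $\delta^{\bar\alpha}(q,\sigma)$ is the set of $\sigma$-successors of $q$ via $\bar\alpha$-transitions. A run on $w=\sigma_1\sigma_2\cdots$ is $r_0r_1\cdots$ with $r_0=q_0$, $r_{i+1}\in\delta(r_i,\sigma_{i+1})$, accepting iff it traverses $\alpha$-transitions only finitely often; $L(\mathcal{A})$ is the set of accepted words; the size is $|Q|$. $\mathcal{A}^q$ is $\mathcal{A}$ with initial state $q$. $\mathcal{A}$ is GFG if there is $f:\Sigma^*\to Q$ with $f(\epsilon)=q_0$, $\langle f(u),\sigma,f(u\sigma)\rangle\in\Delta$ for all $u,\sigma$, and for every $w\in L(\mathcal{A})$ the run $f(w[1,0]),f(w[1,1]),\dots$ is accepting; a state $q$ is GFG if $\mathcal{A}^q$ is. A run is safe if it uses no $\alpha$-transition; $L_{safe}(\mathcal{A}^q)$ is the set of infinite words with a safe run from $q$. $q\sim s$ iff $L(\mathcal{A}^q)=L(\mathcal{A}^s)$;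 $q\approx s$ iff $q\sim s$ and $L_{safe}(\mathcal{A}^q)=L_{safe}(\mathcal{A}^s)$; $q\precsim s$ iff $q\sim s$ and $L_{safe}(\mathcal{A}^q)\subseteq L_{safe}(\mathcal{A}^s)$. Safe components are the SCCs of the graph on $Q$ with an edge $q\to q'$ iff some $\bar\alpha$-transition $\langle q,\sigma,q'\rangle$ exists. $\mathcal{A}$ is semantically deterministic if any two $\sigma$-successors of any state are $\sim$-equivalent; safe deterministic if $|\delta^{\bar\alpha}(q,\sigma)|\le1$ always; normal if a path of $\bar\alpha$-transitions from $q$ to $s$ implies one from $s$ to $q$. A GFG-tNCW is nice if all states are reachable and GFG and it is normal, safe deterministic and semantically deterministic. It is safe-centralized if $q\precsim s$ implies $q,s$ are in the same safe component, and safe-minimal if no two distinct states $q,s$ satisfy $q\approx s$. *)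

(* Defs.v *)
From mathcomp Require Import all_boot.

Set Implicit Arguments.
Unset Strict Implicit.
Unset Printing Implicit Defensive.

Record tncw (Sigma : finType) : Type := TNCW {
  state :> finType;
  init : state;
  trans : state -> Sigma -> {set state};
  alpha : {set state * Sigma * state};
  trans_total : forall q a, trans q a != set0;
  alpha_trans : forall q a s, (q, a, s) \in alpha -> s \in trans q a
}.

Arguments init {Sigma} A : rename.
Arguments trans {Sigma} A : rename.
Arguments alpha {Sigma} A : rename.

(* The word sigma_1 sigma_2 ... is the function i |-> sigma_(i+1), so the
   transition from r i to r i.+1 reads w i, and w[1,i] is mkseq w i. *)
Definition word (Sigma : finType) : Type := nat -> Sigma.

Section Tncw.
Variable Sigma : finType.
Implicit Types (A B : tncw Sigma) (w : word Sigma).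

Definition with_init A (q : A) : tncw Sigma :=
  TNCW q (@trans_total Sigma A) (@alpha_trans Sigma A).

Definition delta A : {set A * Sigma * A} :=
  [set t | t.2 \in trans A t.1.1 t.1.2].

Definition safe_trans A (q : A) (a : Sigma) : {set A} :=
  [set s in trans A q a | (q, a, s) \notin alpha A].

Definition is_run A w (r : nat -> A) : Prop :=
  r 0 = init A /\ forall i, r i.+1 \in trans A (r i) (w i).

Definition accepting A w (r : nat -> A) : Prop :=
  exists N, forall i, N <= i -> (r i, w i, r i.+1) \notin alpha A.

Definition safe A w (r : nat -> A) : Prop :=
  forall i, (r i, w i, r i.+1) \notin alpha A.

Definition lang A w : Prop := exists2 r, is_run w r & @accepting A w r.

Definition safe_lang A w : Prop := exists2 r, is_run w r & @safe A w r.

Definition gfg A : Prop :=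
  exists f : seq Sigma -> A,
    [/\ f [::] = init A,
        forall u a, (f u, a, f (rcons u a)) \in delta A
      & forall w, lang A w -> accepting w (fun i => f (mkseq w i))].

Definition gfg_state A (q : A) : Prop := gfg (with_init q).

Definition lang_equiv A (q s : A) : Prop :=
  forall w, lang (with_init q) w <-> lang (with_init s) w.

Definition strong_equiv A (q s : A) : Prop :=
  lang_equiv q s /\
  forall w, safe_lang (with_init q) w <-> safe_lang (with_init s) w.

Definition subsafe_equiv A (q s : A) : Prop :=
  lang_equiv q s /\
  forall w, safe_lang (with_init q) w -> safe_lang (with_init s) w.

Definition edge A : rel A := fun q s => [exists a, s \in trans A q a].

Definition safe_edge A : rel A := fun q s => [exists a, s \in safe_trans q a].

Definition safe_component A (q : A) : {set A} :=
  [set s | connect (@safe_edge A) q s && connect (@safe_edge A) s q].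

Definition all_reachable A : Prop := forall q, connect (@edge A) (init A) q.

Definition semantically_deterministic A : Prop :=
  forall (q : A) a s s',
    s \in trans A q a -> s' \in trans A q a -> lang_equiv s s'.

Definition safe_deterministic A : Prop :=
  forall (q : A) a, #|safe_trans q a| <= 1.

Definition normal A : Prop :=
  forall q s, connect (@safe_edge A) q s -> connect (@safe_edge A) s q.

Definition nice A : Prop :=
  [/\ all_reachable A, forall q : A, gfg_state q, normal A,
      safe_deterministic A & semantically_deterministic A].

Definition safe_centralized A : Prop :=
  forall q s : A, subsafe_equiv q s -> s \in safe_component q.

Definition safe_minimal A : Prop :=
  forall q s : A, strong_equiv q s -> q = s.

Definition gfg_minimal A : Prop :=
  forall B, gfg B -> (forall w, lang B w <-> lang A w) -> #|A| <= #|B|.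

End Tncw.

(* Main.v *)
(* If [q] and [s] violate safe-centrality or safe-minimality, some states can be
   removed.  Fix a smaller state space [T], read as states of [A] through
   [e : T -> A], and a map [h : A -> T] such that every state [p] of [A] is
   language equivalent to [e (h p)] and safely reads no more words than it.
   Redirect every safe transition of [A] to [p] into a safe transition to [h p],
   and add as alpha-transitions all the moves respecting language equivalence.
   Whenever the safe move of the new automaton gets stuck, it can jump to [h p],
   where [p] is the current state of a GFG strategy of [A]; once that strategy
   has become safe, a single jump is enough to remain safe forever.
   For two strongly equivalent states, [h] identifies them; for [q] subsafe
   equivalent to [s] in another component, [h] maps the whole safe component of
   [q] into that of [s]. *)
Require Import Defs.
From mathcomp Require Import all_boot.
From mathcomp Require Import boolp.

Set Implicit Arguments.
Unset Strict Implicit.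
Unset Printing Implicit Defensive.

(** * Infinite words: tails, prefixing, prefixes *)

Section Words.
Variable Sigma : finType.
Implicit Types w : word Sigma.

Definition wtail w : word Sigma := fun i => w i.+1.
Definition wcons a w : word Sigma := fun i => if i is j.+1 then w j else a.
Definition wdrop n w : word Sigma := fun i => w (n + i).

Lemma wdrop0 w : wdrop 0 w = w.
Proof. by []. Qed.

Lemma wtail_drop n w : wtail (wdrop n w) = wdrop n.+1 w.
Proof. by apply: funext => i; rewrite /wtail /wdrop addnS. Qed.

Lemma wdrop_head n w : wdrop n w 0 = w n.
Proof. by rewrite /wdrop addn0. Qed.

Lemma mkseq_wtail w n : mkseq w n.+1 = w 0 :: mkseq (wtail w) n.
Proof. by rewrite /mkseq /= -[1]addn0 iotaDl -map_comp. Qed.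

End Words.

(** * Language equivalence along transitions *)

Section Language.
Variables (Sigma : finType) (A : tncw Sigma).
Implicit Types (p q s : A) (a : Sigma) (w : word Sigma).

Lemma lang_equiv_sym p q : lang_equiv p q -> lang_equiv q p.
Proof. by move=> pq w; apply: iff_sym. Qed.

Lemma lang_equiv_trans p q s :
  lang_equiv p q -> lang_equiv q s -> lang_equiv p s.
Proof. by move=> pq qs w; apply: iff_trans (pq w) (qs w). Qed.

Lemma lang_cons p q w :
  q \in trans A p (w 0) -> lang (with_init q) (wtail w) -> lang (with_init p) w.
Proof.
move=> pq [r [r0 rS] [N rN]].
exists (fun i => if i is j.+1 then r j else p).
  by split=> // -[|i] /=; [rewrite r0 | exact: rS].
by exists N.+1 => -[|i] //; rewrite ltnS => /rN.
Qed.

Lemma lang_uncons p w :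
  lang (with_init p) w ->
  exists2 q, q \in trans A p (w 0) & lang (with_init q) (wtail w).
Proof.
move=> [r [r0 rS] [N rN]]; exists (r 1); first by rewrite -[p]r0; exact: rS.
exists (fun i => r i.+1); first by split=> // i; exact: rS.
by exists N => i leNi; apply: rN; exact: leqW.
Qed.

Lemma safe_lang_lang p w : safe_lang (with_init p) w -> lang (with_init p) w.
Proof. by case=> r rP rsafe; exists r => //; exists 0. Qed.

(** Prefixing [a] carries a word of one successor to its source, hence to the equivalent source.
    There it is accepted through some [a]-successor, and semantic determinism makes all of these
    equivalent. *)
Lemma succ_lang_equiv p q p' q' a :
    semantically_deterministic A -> lang_equiv p q ->
    p' \in trans A p a -> q' \in trans A q a ->
  lang_equiv p' q'.
Proof.
move=> sd.
suff sub x y x' y' : lang_equiv x y -> x' \in trans A x a ->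
    y' \in trans A y a ->
    forall w, lang (with_init x') w -> lang (with_init y') w.
  move=> pq pp' qq' w; split; first exact: sub pp' qq' w.
  exact: sub (lang_equiv_sym pq) qq' pp' w.
move=> xy xx' yy' w x'w.
have /xy/lang_uncons [y'' yy'' y''w] : lang (with_init x) (wcons a w).
  exact: lang_cons x'w.
exact/(sd _ _ _ _ yy'' yy').
Qed.

End Language.

(** * Safe languages through finite words *)

Section SafeReading.
Variables (Sigma : finType) (A : tncw Sigma).
Hypothesis sdA : safe_deterministic A.
Implicit Types (p q s : A) (a : Sigma) (w : word Sigma) (u v : seq Sigma).

Definition safe_step p a : option A := [pick s in safe_trans p a].

Fixpoint safe_read p u : option A :=
  if u is a :: u' then obind (safe_read^~ u') (safe_step p a) else Some p.

(** The finite-word counterpart of safe-language inclusion; unlike the infinite version, it also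
    speaks of states where every safe run gets stuck. *)
Definition safe_sub p q : Prop := forall u, safe_read p u -> safe_read q u.

Lemma safe_stepP p a s : reflect (safe_step p a = Some s) (s \in safe_trans p a).
Proof.
rewrite /safe_step; case: pickP => [s' ps'|no]; last first.
  by have := no s => /= ->; constructor.
apply: (iffP idP) => [ps|[<-] //].
by have /card_le1_eqP/(_ _ _ ps' ps) -> := sdA p a.
Qed.

Lemma safe_step_in p a s : safe_step p a = Some s -> s \in safe_trans p a.
Proof. by move/safe_stepP. Qed.

Lemma safe_read_cat p u v :
  safe_read p (u ++ v) = obind (safe_read^~ v) (safe_read p u).
Proof. by elim: u p => //= a u IHu p; case: (safe_step p a) => /=. Qed.

Lemma safe_sub_refl p : safe_sub p p.
Proof. by []. Qed.

Lemma safe_sub_read p q u p' :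
  safe_sub p q -> safe_read p u = Some p' ->
  exists2 q', safe_read q u = Some q' & safe_sub p' q'.
Proof.
move=> pq pu; have := pq u; rewrite pu => /(_ isT).
case qu: (safe_read q u) => [q'|] // _; exists q' => // v p'v.
by have := pq (u ++ v); rewrite !safe_read_cat pu qu; apply.
Qed.

Lemma safe_read_run w (r : nat -> A) n :
  (forall i, r i.+1 \in safe_trans (r i) (w i)) ->
  safe_read (r 0) (mkseq w n) = Some (r n).
Proof.
elim: n w r => // n IHn w r rP; rewrite mkseq_wtail /=.
have /safe_stepP -> /= := rP 0.
by rewrite (IHn _ (fun i => r i.+1)) // => i; exact: rP.
Qed.

(** By safe determinism the safe runs on the prefixes of [w] extend one another, so they glue into
    one infinite run. *)
Lemma safe_langP p w :
  safe_lang (with_init p) w <-> forall n, safe_read p (mkseq w n).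
Proof.
split=> [[r [r0 rS] rsafe] n|pw].
  rewrite -[p]r0 (@safe_read_run w r) // => i.
  by rewrite inE rS rsafe.
pose r n := odflt p (safe_read p (mkseq w n)).
have rP i : r i.+1 \in safe_trans (r i) (w i).
  apply/safe_stepP; have := pw i.+1; rewrite /r mkseqS -cats1 safe_read_cat.
  case: (safe_read p (mkseq w i)) => //= q.
  by case: (safe_step q (w i)).
by exists r; [split=> // i | move=> i]; have := rP i; rewrite inE => /andP[].
Qed.

Lemma safe_lang_cons p q a w :
  q \in safe_trans p a -> safe_lang (with_init q) w ->
  safe_lang (with_init p) (wcons a w).
Proof.
move=> /safe_stepP pq /safe_langP qw; apply/safe_langP => -[|n] //.
by rewrite mkseq_wtail /= pq /=; exact: qw.
Qed.

Lemma safe_trans_edge p a s : s \in safe_trans p a -> safe_edge p s.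
Proof. by move=> ps; apply/existsP; exists a. Qed.

Lemma connect_safe_read p q :
  connect (@safe_edge _ A) p q -> exists u, safe_read p u = Some q.
Proof.
case/connectP=> c; elim: c p => [|s c IHc] p /=; first by move=> _ ->; exists [::].
case/andP=> /existsP[a /safe_stepP ps] /IHc{}IHc /IHc[u su].
by exists (a :: u); rewrite /= ps.
Qed.

Lemma safe_read_connect p u q :
  safe_read p u = Some q -> connect (@safe_edge _ A) p q.
Proof.
elim: u p => [|a u IHu] p /=; first by case=> ->; exact: connect0.
case ps: (safe_step p a) => [s|] //= /IHu; apply: connect_trans.
by apply/connect1/safe_trans_edge/safe_step_in/ps.
Qed.

Hypothesis normA : normal A.

Definition live p : bool := [exists a, exists s, s \in safe_trans p a].

Lemma liveI p a s : s \in safe_trans p a -> live p.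
Proof. by move=> ps; apply/existsP; exists a; apply/existsP; exists s. Qed.

Lemma live_succ p a s : s \in safe_trans p a -> live s.
Proof.
(* Normality gives a safe path back to [p]: either it is empty and [s] is [p], or its first edge
   leaves [s]. *)
move=> ps; have /connectP[[|t c] /=] := normA (connect1 (safe_trans_edge ps)).
  by move=> _ eq_ps; move: (ps); rewrite {1}eq_ps => /liveI.
by move=> /andP[/existsP[b st] _] _; exact: liveI st.
Qed.

Lemma live_safe_lang p : live p -> exists w, safe_lang (with_init p) w.
Proof.
move=> pl; have /existsP[a0 _] := pl.
pose next q := odflt (a0, q) [pick t : Sigma * A | t.2 \in safe_trans q t.1].
have nextP q : live q -> (next q).2 \in safe_trans q (next q).1.
  case/existsP=> a /existsP[s qs]; rewrite /next.
  by case: pickP => [//|/(_ (a, s))/=]; rewrite qs.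
pose r n := iter n (fun q => (next q).2) p.
have rl n : live (r n).
  by elim: n => // n IHn; exact: live_succ (nextP _ IHn).
exists (fun n => (next (r n)).1); apply/safe_langP => n.
by rewrite (@safe_read_run _ r) // => i; apply: nextP.
Qed.

Lemma safe_read_extend p u :
  live p -> safe_read p u ->
  exists2 w, safe_lang (with_init p) w & mkseq w (size u) = u.
Proof.
elim: u p => [|a u IHu] p pl /=.
  by have [w pw] := live_safe_lang pl; exists w.
case ps: (safe_step p a) => [s|] //=; move/safe_step_in: ps => ps.
case/(IHu _ (live_succ ps)) => w sw wu; exists (wcons a w).
  exact: safe_lang_cons sw.
by rewrite mkseq_wtail wu.
Qed.

(* Normality is essential here: a safe transition never leads to a state without
   outgoing safe transitions, so finite safe words extend to infinite ones. *)
Lemma safe_sub_of_lang p q :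
  (forall w, safe_lang (with_init p) w -> safe_lang (with_init q) w) ->
  safe_sub p q.
Proof.
move=> pq [|a u] // pu.
have pl : live p.
  move: pu => /=; case ps: (safe_step p a) => [s|] // _.
  exact/liveI/safe_step_in/ps.
have [w /pq/safe_langP qw wu] := safe_read_extend pl pu.
by rewrite -wu.
Qed.

End SafeReading.

(** * The reduced automaton and its language *)

Section Reduction.
Variables (Sigma : finType) (A : tncw Sigma).
Hypotheses (sdA : safe_deterministic A) (semA : semantically_deterministic A).
Variables (T : finType) (e : T -> A) (h : A -> T).
Hypothesis h_equiv : forall p, lang_equiv p (e (h p)).
Hypothesis h_sub : forall p, safe_sub p (e (h p)).
Hypothesis h_safe : forall x a p,
  p \in safe_trans (e x) a -> safe_sub (e (h p)) p.

(** Allowing every target equivalent to a successor makes the jumps of the strategy below legal. *)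
Definition red_trans (x : T) (a : Sigma) : {set T} :=
  [set y | [exists s in trans A (e x) a, `[< lang_equiv s (e y) >]]].

Definition red_alpha : {set T * Sigma * T} :=
  [set t | (t.2 \in red_trans t.1.1 t.1.2)
             && (t.2 \notin [set h s | s in safe_trans (e t.1.1) t.1.2])].

Lemma red_transP x a y :
  reflect (exists2 s, s \in trans A (e x) a & lang_equiv s (e y))
          (y \in red_trans x a).
Proof.
by rewrite inE; apply: (iffP exists_inP) => [] [s xs /asboolP]; exists s.
Qed.

Lemma red_trans_total x a : red_trans x a != set0.
Proof.
have /set0Pn[s xs] := @trans_total _ A (e x) a.
by apply/set0Pn; exists (h s); apply/red_transP; exists s.
Qed.

Lemma red_alpha_trans x a y : (x, a, y) \in red_alpha -> y \in red_trans x a.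
Proof. by rewrite inE => /andP[]. Qed.

Definition reduction : tncw Sigma :=
  TNCW (h (init A)) red_trans_total red_alpha_trans.

(** Redirection creates no new safe words: by [h_safe], whatever [e (h s)] reads after a redirected
    step, the original target [s] reads too. *)
Lemma reduction_safe_read (w : word Sigma) (r : nat -> T) :
    (forall i, exists2 s, s \in safe_trans (e (r i)) (w i) & r i.+1 = h s) ->
  forall n, safe_read (e (r 0)) (mkseq w n).
Proof.
move=> rP n; elim: n w r rP => // n IHn w r rP.
rewrite mkseq_wtail /=; have [s rs r1] := rP 0.
rewrite (safe_stepP sdA _ _ _ rs) /=.
apply: (h_safe rs); rewrite -r1.
by apply: (IHn _ (fun i => r i.+1)) => i; exact: rP.
Qed.

Lemma reduction_lang_sub (w : word Sigma) : lang reduction w -> lang A w.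
Proof.
case=> r [r0 rS] [N rN].
(* Acceptance of a suffix is pulled back to the initial state, as every transition of the reduction
   mirrors one of [A] up to equivalence. *)
have back n : lang (with_init (e (r n))) (wdrop n w) -> lang A w.
  elim: n => [|n IHn].
    by rewrite wdrop0 r0 => hw; exact: (h_equiv (init A) w).2 hw.
  have /red_transP[s rs s_equiv] := rS n.
  move=> /s_equiv; rewrite -wtail_drop => sw; apply: IHn.
  by apply: lang_cons sw; rewrite wdrop_head.
apply: (back N); apply: safe_lang_lang; apply/(safe_langP sdA).
rewrite -[N in r N]addn0.
apply: (@reduction_safe_read _ (fun i => r (N + i))) => i.
have := rN _ (leq_addr i N); rewrite inE /= (rS (N + i)) /= negbK.
by case/imsetP=> s rs rE; exists s => //; rewrite addnS.
Qed.

(** * A GFG strategy for the reduced automaton *)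

Section Strategy.
Variable f : seq Sigma -> A.
Hypothesis f0 : f [::] = init A.
Hypothesis f_trans : forall u a, (f u, a, f (rcons u a)) \in delta A.

(** The word is stored reversed, so that structural recursion peels off the last letter read. *)
Fixpoint red_strategy_rev (v : seq Sigma) : T :=
  if v is a :: v' then
    if safe_step (e (red_strategy_rev v')) a is Some s then h s
    else h (f (rev v))
  else h (init A).

Definition red_strategy (u : seq Sigma) : T := red_strategy_rev (rev u).
Local Notation g := red_strategy.

Lemma red_strategy_rcons u a :
  g (rcons u a) =
  if safe_step (e (g u)) a is Some s then h s else h (f (rcons u a)).
Proof. by rewrite /g rev_rcons /= -rev_rcons revK. Qed.

Lemma red_strategy_step u a :
    lang_equiv (e (g u)) (f u) ->
  lang_equiv (e (g (rcons u a))) (f (rcons u a)) /\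
  g (rcons u a) \in red_trans (g u) a.
Proof.
move=> gf; have := f_trans u a; rewrite inE /= => fS.
rewrite red_strategy_rcons; case gs: (safe_step _ a) => [s|].
  move/(safe_step_in sdA): gs; rewrite inE => /andP[gs _]; split.
    apply: lang_equiv_trans (lang_equiv_sym (h_equiv s)) _.
    exact: succ_lang_equiv gf gs fS.
  by apply/red_transP; exists s.
split; first exact: lang_equiv_sym.
have /set0Pn[s gs'] := @trans_total _ A (e (g u)) a.
apply/red_transP; exists s => //; apply: lang_equiv_trans (h_equiv _).
exact: succ_lang_equiv gf gs' fS.
Qed.

Lemma red_strategy_equiv u : lang_equiv (e (g u)) (f u).
Proof.
elim/last_ind: u => [|u a IHu].
  by rewrite f0; apply: lang_equiv_sym; apply: h_equiv.
by have [] := red_strategy_step a IHu.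
Qed.

Lemma red_strategy_trans u a : g (rcons u a) \in red_trans (g u) a.
Proof. by have [] := red_strategy_step a (red_strategy_equiv u). Qed.

Variable w : word Sigma.
Let gw i := g (mkseq w i).
Let fw i := f (mkseq w i).

(** If the suffix is safely readable now, the safe step exists and its target [s] reads the rest; by
    [h_sub] so does [e (h s)], hence the strategy never jumps again. *)
Lemma red_strategy_safe i :
    (forall n, safe_read (e (gw i)) (mkseq (wdrop i w) n)) ->
  forall j, i <= j -> (gw j, w j, gw j.+1) \notin red_alpha.
Proof.
move=> gi j /subnK <-; move: (j - i) => k {j}.
suff [] : (forall n, safe_read (e (gw (k + i))) (mkseq (wdrop (k + i) w) n)) /\
  (gw (k + i), w (k + i), gw (k + i).+1) \notin red_alpha by [].
have step j : (forall n, safe_read (e (gw j)) (mkseq (wdrop j w) n)) ->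
    exists2 s, s \in safe_trans (e (gw j)) (w j) & gw j.+1 = h s /\
      forall n, safe_read s (mkseq (wdrop j.+1 w) n).
  move=> gj; case gs: (safe_step (e (gw j)) (w j)) (gj 1) => [s|]; last first.
    by rewrite /= wdrop_head gs.
  move=> _; exists s; first exact: (safe_step_in sdA).
  split=> [|n]; first by rewrite /gw mkseqS red_strategy_rcons -/(gw j) gs.
  by have := gj n.+1; rewrite mkseq_wtail wtail_drop wdrop_head /= gs.
have inv j : (forall n, safe_read (e (gw (j + i))) (mkseq (wdrop (j + i) w) n)).
  elim: j => // j /step[s _ [gS sP]] n.
  by rewrite addSn gS; apply/h_sub/sP.
split=> //; have [s gs [-> _]] := step _ (inv k).
by rewrite inE /= negb_and negbK imset_f // orbT.
Qed.

Lemma red_strategy_accepting :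
  (exists N, forall i, N <= i -> (fw i, w i, fw i.+1) \notin alpha A) ->
  exists N, forall i, N <= i -> (gw i, w i, gw i.+1) \notin red_alpha.
Proof.
case=> N fN.
(* Either no alpha-transition occurs from [N] on, or the one at [i] is the last. *)
have [[i [leNi bad]]|none] := EM (exists i, N <= i /\
    (gw i, w i, gw i.+1) \in red_alpha); last first.
  exists N => i leNi; apply/negP => bad; apply: none; by exists i.
exists i.+1; apply: red_strategy_safe => n.
(* An alpha-transition of the strategy can only be a jump. It lands on [h] of a state from which the
   run of [f] is already safe. *)
have gS : gw i.+1 = h (fw i.+1).
  move: bad; rewrite inE /= /gw mkseqS red_strategy_rcons -/(gw i).
  case gs: (safe_step _ _) => [s|]; last by rewrite /fw mkseqS.
  by rewrite imset_f ?andbF //; exact: (safe_step_in sdA).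
rewrite gS; apply: h_sub.
have /= := @safe_read_run _ _ sdA (wdrop i.+1 w) (fun j => fw (i.+1 + j)) n.
rewrite addn0 => -> // j.
rewrite addnS inE fN; last exact: leq_trans leNi (leqW (leq_addr j i)).
by have := f_trans (mkseq w (i.+1 + j)) (w (i.+1 + j)); rewrite inE -mkseqS /= => ->.
Qed.

End Strategy.

Lemma reduction_gfg : gfg A ->
  gfg reduction /\ forall w, lang reduction w <-> lang A w.
Proof.
case=> f [f0 f_trans f_acc]; split=> [|w].
  exists (red_strategy f); split=> // [u a|w /reduction_lang_sub/f_acc fw].
    by rewrite inE /=; exact: red_strategy_trans.
  exact: red_strategy_accepting.
split=> [|/f_acc fw]; first exact: reduction_lang_sub.
exists (fun i => red_strategy f (mkseq w i)); last exact: red_strategy_accepting.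
by split=> // i; rewrite mkseqS; exact: red_strategy_trans.
Qed.

Lemma gfg_minimal_card : gfg A -> gfg_minimal A -> #|A| <= #|T|.
Proof. by move=> gA /(_ reduction); case: (reduction_gfg gA) => gB eqL; apply. Qed.

End Reduction.

(** * Removing states that violate minimality *)

Lemma card_sig_lt (T : finType) (P : pred T) x :
  ~~ P x -> #|{: {y | P y}}| < #|T|.
Proof.
move=> Px; rewrite card_sig -(cardC [pred y | P y]) -[X in X < _]addn0 ltn_add2l.
by apply/card_gt0P; exists x.
Qed.

Lemma gfg_minimal_safe_minimal (Sigma : finType) (A : tncw Sigma) :
  gfg A -> nice A -> gfg_minimal A -> safe_minimal A.
Proof.
move=> gA [_ _ nA sdA semA] mA q s [qs qs_safe].
apply/eqP/negPn/negP => neq_qs.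
have sub_qs : safe_sub q s by apply: safe_sub_of_lang => // w /qs_safe.
have sub_sq : safe_sub s q by apply: safe_sub_of_lang => // w /qs_safe.
pose T := {p : A | p != s}.
(* The default value of [insubd] sends the removed state [s] to [q]. *)
pose h : A -> T := insubd (Sub q neq_qs).
have hE p : val (h p) = if p == s then q else p.
  by rewrite val_insubd; case: eqP.
suff : #|A| <= #|{: T}| by rewrite leqNgt (@card_sig_lt _ _ s) ?eqxx.
apply: (@gfg_minimal_card _ _ sdA semA _ val h) => // p.
- by rewrite hE; case: eqP => // ->; exact: lang_equiv_sym.
- by rewrite hE; case: eqP => [->|_] //.
- by move=> a p' _; rewrite hE; case: eqP => [->|_] //.
Qed.

Lemma gfg_minimal_safe_centralized (Sigma : finType) (A : tncw Sigma) :
  gfg A -> nice A -> gfg_minimal A -> safe_centralized A.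
Proof.
move=> gA [_ _ nA sdA semA] mA q s [qs qs_safe].
apply/negPn/negP => s_notin.
have sub_qs : safe_sub q s by apply: safe_sub_of_lang.
have compE p : (p \in safe_component q) = connect (@safe_edge _ A) q p.
  by rewrite inE; apply: andb_idr => /nA.
pose T := {p : A | p \notin safe_component q}.
(* A state of the component is reached from [q] by safely reading some [u]; its image is the state
   that [s] reaches on the same [u]. *)
have /fin_all_exists[h hP] p : exists t : T,
    [/\ lang_equiv p (val t), safe_sub p (val t)
      & p \notin safe_component q -> val t = p].
  have [p_in|p_out] := boolP (p \in safe_component q); last first.
    by exists (Sub p p_out); split=> /=; [|exact: safe_sub_refl|].
  move: (p_in); rewrite compE => /(connect_safe_read sdA)[u qu].
  have [t su sub_pt] := safe_sub_read sub_qs qu.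
  (* Otherwise normality would lead from [q] through [t] back to [s]. *)
  have t_out : t \notin safe_component q.
    rewrite compE; apply: contra s_notin => qt; rewrite compE.
    exact: connect_trans qt (nA _ _ (safe_read_connect sdA su)).
  exists (Sub t t_out); split=> //=.
  (* Language equivalence of [q] and [s] propagates along [u]. *)
  elim: u q s qs qu su {qs_safe s_notin sub_qs compE T p_in t_out} => [|a u IHu] q s qs /=.
    by case=> <- [<-].
  case qq': (safe_step q a) => [q'|] //=; case ss': (safe_step s a) => [s'|] //=.
  move/(safe_step_in sdA): qq'; move/(safe_step_in sdA): ss'.
  rewrite !inE => /andP[ss' _] /andP[qq' _].
  by apply: IHu; exact: succ_lang_equiv qs qq' ss'.
suff : #|A| <= #|{: T}|.
  by rewrite leqNgt (@card_sig_lt _ _ q) // negbK compE connect0.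
apply: (@gfg_minimal_card _ _ sdA semA _ val h) => //.
- by move=> p; have [] := hP p.
- by move=> p; have [] := hP p.
(* By normality, safe transitions from outside the component stay outside, where [h] fixes every
   state. *)
move=> [x x_out] a p /= xp; have [_ _ ->] := hP p; first exact: safe_sub_refl.
rewrite compE; apply: contra x_out => qp; rewrite compE.
exact: connect_trans qp (nA _ _ (connect1 (safe_trans_edge xp))).
Qed.

Theorem theorem4p1 (Sigma : finType) (A : tncw Sigma) :
  gfg A -> nice A -> gfg_minimal A -> safe_centralized A /\ safe_minimal A.
Proof.
move=> gA nA mA; split; first exact: gfg_minimal_safe_centralized.
exact: gfg_minimal_safe_minimal.
Qed.
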